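(* Let $a \in \mathbb{Z}^n$ be non-zero and $b\in\mathbb{Z}$, and let $\mathcal{P}_I = \operatorname{Conv}(\{x\in\mathbb{R}^n : a^\top x = b,\ x\ge 0\}\cap\mathbb{Z}^n)$ be the integer hull of the knapsack polytope. Then every vertex $v$ of $\mathcal{P}_I$ satisfies $|\operatorname{supp}(v)| \le \log(3.51\cdot \lVert a[\operatorname{supp}(v)]\rVert_2)$.
   Context: All logarithms are base 2. Entries of $a$ may be negative. $\operatorname{supp}(v)=\{i: v_i\neq 0\}$; for an index set $S$, $a[S]$ denotes the subvector of $a$ consisting of the entries indexed by $S$. A vertex of $\mathcal{P}_I$ is a point $v\in\mathcal{P}_I$ with $v\notin\operatorname{Conv}(\mathcal{P}_I\setminus\{v\})$. *)

(* Defs.v *)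
From HB Require Import structures.
From mathcomp Require Import all_boot all_order all_algebra.
From mathcomp Require Import all_classical all_reals all_analysis.

Set Implicit Arguments.
Unset Strict Implicit.
Unset Printing Implicit Defensive.

Import Order.TTheory GRing.Theory Num.Theory.

Local Open Scope classical_set_scope.
Local Open Scope ring_scope.

Definition conv_hull (R : realType) (E : lmodType R) (A : set E) : set E :=
  smallest (@convex_set R E) A.

Definition vertex (R : realType) (E : lmodType R) (P : set E) (v : E) : Prop :=
  P v /\ ~ conv_hull (P `\ v) v.

Definition knapsack (R : realType) (n : nat) (a : 'rV[int]_n) (b : int) :
    set 'rV[R]_n :=
  [set x | \sum_(i < n) (a 0 i)%:~R * x 0 i = b%:~R /\ forall i, 0 <= x 0 i].

Definition integer_points (R : realType) (n : nat) : set 'rV[R]_n :=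
  [set x | forall i, x 0 i \is a Num.int].

Definition integer_hull (R : realType) (n : nat) (P : set 'rV[R]_n) :
    set 'rV[R]_n :=
  conv_hull (P `&` @integer_points R n).

Definition supp (R : realType) (n : nat) (v : 'rV[R]_n) : {set 'I_n} :=
  [set i | v 0 i != 0]%SET.

(* a[S], with the entries indexed by S kept in increasing order of index. *)
Definition subvector (T : Type) (n : nat) (a : 'rV[T]_n) (S : {set 'I_n}) :
    'rV[T]_#|S| :=
  \row_(j < #|S|) a 0 (enum_val j).

(* Euclidean norm; the library norm on matrices is the sup norm. *)
Definition norm2 (R : realType) (m : nat) (u : 'rV[int]_m) : R :=
  Num.sqrt (\sum_(j < m) (u 0 j)%:~R ^+ 2).

(* [ln x = 0] for [x <= 0], so [log2 0 = 0]; a bound by [log2] of the norm of the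
   empty vector (the vertex 0) is thus a bound by 0. *)
Definition log2 (R : realType) (x : R) : R := ln x / ln 2.

(* Main.v *)
Require Import Defs.
From mathcomp Require Import all_boot all_order all_algebra.
From mathcomp Require Import ring lra.
From mathcomp Require Import all_classical all_reals all_analysis.

Set Implicit Arguments.
Unset Strict Implicit.
Unset Printing Implicit Defensive.

Import Order.TTheory GRing.Theory Num.Theory.

Local Open Scope ring_scope.

(** Let [s] be the size of the support of the vertex [v]. The [2 ^ s] subset
    sums of the entries of [a] on the support are distinct integers, since two
    equal ones would make [v] the midpoint of two other feasible integer points.
    Distinct integers are spread out: the mean squared deviation of [2 ^ s] of
    them from any centre is at least [(4 ^ s - 1) / 12]. About half the total,
    the mean squared deviation of the subset sums is exactly [q / 4], where [q]
    is the squared norm of [a] on the support. Therefore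
    [4 ^ s <= 3 q + 1 <= 4 q] for [s > 0], which gives the bound even with the
    constant 2 in place of 3.51. *)

Section SeparatedPoints.
Variables (R : realDomainType) (d : R).

Definition gapped : rel R := [rel x y | x + d <= y].

Lemma path_gapped_le (x y : R) (s : seq R) :
  path gapped x (rcons s y) -> x + (size s).+1%:R * d <= y.
Proof.
elim: s x => [|z s IHs] x /=; rewrite {1}/gapped /=.
  by rewrite andbT mul1r.
move=> /andP[xz /IHs]; apply: le_trans.
by rewrite -addn1 natrD mulrDl mul1r; lra.
Qed.

(* The two extreme points of [s] contribute at least half the square of their
   distance, which is at least [(size s - 1) * d]; remove them and induct. *)
Lemma sum_sqr_dev_gapped_ge (t : R) (s : seq R) :
  0 <= d -> sorted gapped s ->
  d ^+ 2 * (size s)%:R * ((size s)%:R ^+ 2 - 1) <=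
    12 * \sum_(x <- s) (x - t) ^+ 2.
Proof.
move=> d_ge0; have [m] := ubnP (size s); elim: m s => // m IHm [_ _|x s].
  by rewrite big_nil !mulr0 mul0r.
case: (lastP s) => [_ _|{}s y].
  by rewrite big_seq1 expr1n subrr mulr0 mulr_ge0 ?sqr_ge0.
rewrite /= size_rcons !ltnS => /ltnW s_le sorted_s.
have inner : d ^+ 2 * (size s)%:R * ((size s)%:R ^+ 2 - 1) <=
    12 * \sum_(z <- s) (z - t) ^+ 2.
  apply: IHm => //; move: sorted_s; rewrite rcons_path => /andP[+ _].
  exact: path_sorted.
have extremes : ((size s).+1%:R * d) ^+ 2 <= (y - x) ^+ 2.
  have gap := path_gapped_le sorted_s.
  have gap_ge0 : 0 <= (size s).+1%:R * d by rewrite mulr_ge0.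
  by rewrite ler_sqr ?nnegrE; lra.
have sqr_sub_le : (y - x) ^+ 2 <= 2 * ((x - t) ^+ 2 + (y - t) ^+ 2).
  rewrite -subr_ge0 [leRHS](_ : _ = (x + y - 2 * t) ^+ 2) ?sqr_ge0 //.
  by ring.
rewrite big_cons -cats1 big_cat big_seq1 /=.
have -> : (size s).+2%:R = (size s)%:R + 2 :> R by rewrite -natrD addn2.
rewrite -natr1 in extremes; set k := (size s)%:R in inner extremes *.
have -> : d ^+ 2 * (k + 2) * ((k + 2) ^+ 2 - 1) =
    d ^+ 2 * k * (k ^+ 2 - 1) + 6 * ((k + 1) * d) ^+ 2 by ring.
by lra.
Qed.

Lemma sum_sqr_dev_separated_ge (T : finType) (x : T -> R) (t : R) :
  0 < d -> (forall i j, i != j -> d <= `|x i - x j|) ->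
  d ^+ 2 * #|T|%:R * (#|T|%:R ^+ 2 - 1) <= 12 * \sum_i (x i - t) ^+ 2.
Proof.
move=> d_gt0 x_sep.
have x_inj : injective x.
  move=> i j xij; apply: contraTeq d_gt0 => /x_sep.
  by rewrite xij subrr normr0 -leNgt.
pose s := sort <=%O (codom x).
have sorted_s : sorted gapped s.
  apply: (@sub_in_sorted _ [in codom x] <%O); last 2 first.
  - by apply/allP => u; rewrite mem_sort.
  - by rewrite sort_lt_sorted map_inj_uniq ?enum_uniq.
  move=> _ _ /codomP[i ->] /codomP[j ->] xij; rewrite /gapped /=.
  have := x_sep j i; rewrite gtr0_norm ?subr_gt0 // lerBrDl; apply.
  by apply: contraTneq xij => ->; rewrite ltxx.
have := sum_sqr_dev_gapped_ge t (ltW d_gt0) sorted_s.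
rewrite size_sort size_codom (perm_big (codom x)) ?perm_sort //.
by rewrite big_map big_enum.
Qed.

End SeparatedPoints.

Lemma card_finset (I : finType) : #|{set I}| = (2 ^ #|I|)%N.
Proof. by rewrite -[LHS]cardsT -powersetT card_powerset cardsT. Qed.

Definition subset_sum (V : nmodType) (I : finType) (c : I -> V)
    (A : {set I}) : V :=
  \sum_(i in A) c i.

Section SubsetSums.
Variables (R : realFieldType) (I : finType).

Definition subset_sign (A : {set I}) (i : I) : R := (-1) ^+ (i \notin A).

Lemma sum_subset_sign_mul (i j : I) :
  \sum_(A : {set I}) subset_sign A i * subset_sign A j =
    2 ^+ #|I| * (i == j)%:R.
Proof.
have [<-|neq_ij] := eqVneq i j.
  under eq_bigr do rewrite -signr_addb addbb.
  by rewrite sumr_const card_finset natrX mulr1.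
pose toggle (A : {set I}) := [set k | (k \in A) (+) (k == i)]%SET.
have toggleK : involutive toggle.
  by move=> A; apply/finset.setP => k; rewrite !inE -addbA addbb addbF.
have toggle_i A : subset_sign (toggle A) i = - subset_sign A i.
  by rewrite /subset_sign inE eqxx addbT negbK signrN opprK.
have toggle_j A : subset_sign (toggle A) j = subset_sign A j.
  by rewrite /subset_sign inE eq_sym (negbTE neq_ij) addbF.
rewrite mulr0; set S := LHS.
suff : S = - S by lra.
rewrite {1}/S (reindex_inj (inv_inj toggleK)) -sumrN; apply: eq_bigr => A _.
by rewrite toggle_i toggle_j mulNr.
Qed.

Lemma subset_sum_sub_half (c : I -> R) (A : {set I}) :
  subset_sum c A - (\sum_i c i) / 2 = (\sum_i subset_sign A i * c i) / 2.
Proof.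
rewrite /subset_sum [in LHS](bigID [in A] predT) /= [in RHS](bigID [in A]) /=.
have -> : \sum_(i in A) subset_sign A i * c i = \sum_(i in A) c i.
  by apply: eq_bigr => i iA; rewrite /subset_sign iA mul1r.
have -> : \sum_(i | i \notin A) subset_sign A i * c i =
    - \sum_(i | i \notin A) c i.
  by rewrite -sumrN; apply: eq_bigr => i iA; rewrite /subset_sign iA mulN1r.
by field.
Qed.

Lemma sum_sqr_subset_sum_dev (c : I -> R) :
  \sum_(A : {set I}) (subset_sum c A - (\sum_i c i) / 2) ^+ 2 =
    2 ^+ #|I| / 4 * \sum_i c i ^+ 2.
Proof.
transitivity (\sum_i \sum_j c i * c j / 4 *
    \sum_(A : {set I}) subset_sign A i * subset_sign A j).
  under eq_bigr => A _.
    rewrite subset_sum_sub_half expr2 mulrACA big_distrlr mulr_suml /=.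
    under eq_bigr do rewrite mulr_suml.
    over.
  rewrite exchange_big; apply: eq_bigr => i _.
  rewrite exchange_big; apply: eq_bigr => j _.
  by rewrite mulr_sumr; apply: eq_bigr => A _; field.
rewrite mulr_sumr; apply: eq_bigr => i _.
under eq_bigr do rewrite sum_subset_sign_mul.
rewrite (bigD1 i) //= eqxx big1 => [|j /negbTE ji] /=; first by field.
by rewrite eq_sym ji !mulr0.
Qed.

Lemma separated_subset_sums_sum_sqr_ge (d : R) (c : I -> R) :
  0 < d ->
  (forall A B : {set I}, A != B -> d <= `|subset_sum c A - subset_sum c B|) ->
  d ^+ 2 * ((2 ^+ #|I|) ^+ 2 - 1) <= 3 * \sum_i c i ^+ 2.
Proof.
move=> d_gt0 /(sum_sqr_dev_separated_ge ((\sum_i c i) / 2) d_gt0).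
rewrite sum_sqr_subset_sum_dev card_finset natrX => dev_ge.
have pow_gt0 : 0 < 2 ^+ #|I| :> R by rewrite exprn_gt0.
by rewrite -(ler_pM2l pow_gt0); move: dev_ge; lra.
Qed.

End SubsetSums.

Section Norm2.
Variables (R : realType) (m : nat) (u : 'rV[int]_m).

Lemma sqr_norm2 : norm2 R u ^+ 2 = \sum_j (u 0 j)%:~R ^+ 2.
Proof. by rewrite sqr_sqrtr // sumr_ge0 // => j _; rewrite sqr_ge0. Qed.

Lemma injective_subset_sums_norm2_ge :
  injective (subset_sum (u 0)) -> (2 ^+ m) ^+ 2 <= 3 * norm2 R u ^+ 2 + 1.
Proof.
move=> u_inj.
have := @separated_subset_sums_sum_sqr_ge R _ 1 (fun j => (u 0 j)%:~R) ltr01.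
rewrite card_ord expr1n mul1r sqr_norm2 lerBlDr; apply=> A B neqAB.
rewrite /subset_sum -!rmorph_sum -rmorphB norm_intr_ge1 ?intr_int //.
by rewrite intr_eq0 subr_eq0; apply: contra neqAB => /eqP /u_inj ->.
Qed.

End Norm2.

Lemma natr_le_log2 (R : realType) (n : nat) (x : R) :
  0 < x -> (n%:R <= log2 x) = (2 ^+ n <= x).
Proof.
move=> x_gt0; rewrite /log2 ler_pdivlMr ?ln_gt0 ?ltr1n //.
by rewrite mulr_natl -lnXn // ler_ln ?posrE ?exprn_gt0.
Qed.

Lemma injective_subset_sums_le_log2_norm2 (R : realType) (m : nat)
    (u : 'rV[int]_m) (k : R) :
  2 <= k -> injective (subset_sum (u 0)) -> m%:R <= log2 (k * norm2 R u).
Proof.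
move=> k_ge2; case: m u => [|m] u u_inj.
  by rewrite /norm2 big_ord0 sqrtr0 mulr0 /log2 ln0 // mul0r.
have norm2_bound := injective_subset_sums_norm2_ge R u_inj.
have pow_ge2 : 2 <= 2 ^+ m.+1 :> R by rewrite ler_eXnr ?ler1n.
have sqr_norm2_ge1 : 1 <= norm2 R u ^+ 2.
  have : 2 ^+ 2 <= (2 ^+ m.+1) ^+ 2 :> R by rewrite ler_sqr ?nnegrE; lra.
  by move: norm2_bound; lra.
have norm2_gt0 : 0 < norm2 R u.
  by rewrite lt_neqAle sqrtr_ge0 andbT eq_sym -sqrf_eq0 gt_eqF //; lra.
rewrite natr_le_log2; last by rewrite mulr_gt0; lra.
apply: (@le_trans _ _ (2 * norm2 R u)); last by rewrite ler_pM2r.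
by rewrite -ler_sqr ?nnegrE; lra.
Qed.

Lemma convex_set_midpoint (R : numFieldType) (E : lmodType R) (A : set E)
    (v z : E) :
  convex_set A -> A (v + z) -> A (v - z) -> A v.
Proof.
move=> convexA Avz Av_z.
have half_ge0 : (0 : R) <= 2^-1 by rewrite invr_ge0.
have half_le1 : (2^-1 : R) <= 1 by rewrite invf_le1 ?ler1n.
have := convexA _ _ (Itv01 half_ge0 half_le1) (mem_set Avz) (mem_set Av_z).
move/set_mem; congr (A _).
rewrite -[LHS]/(2^-1 *: (v + z) + (1 - 2^-1) *: (v - z)).
have -> : 1 - 2^-1 = 2^-1 :> R by field.
by rewrite -scalerDr addrACA subrr addr0 -mulr2n -scaler_nat scalerK.
Qed.

Lemma conv_hull_convex (R : realType) (E : lmodType R) (A : set E) :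
  convex_set (conv_hull A).
Proof.
move=> x y l /set_mem hull_x /set_mem hull_y; apply: mem_set => M [cM AM].
have [Mx My] := (hull_x M (conj cM AM), hull_y M (conj cM AM)).
exact: set_mem (cM _ _ _ (mem_set Mx) (mem_set My)).
Qed.

Section ConvexHullVertex.
Variables (R : realType) (E : lmodType R) (A : set E) (v : E).
Hypothesis v_vertex : vertex (conv_hull A) v.

Lemma conv_hull_vertex_mem : A v.
Proof.
have [hull_v not_hull] := v_vertex; apply: contrapT => notAv; apply: not_hull.
apply: (sub_smallest2r _ _) hull_v; first exact: conv_hull_convex.
move=> x Ax; split; first exact: sub_gen_smallest.
by move=> xv; apply: notAv; rewrite -xv.
Qed.

Lemma conv_hull_vertex_extreme (z : E) : A (v + z) -> A (v - z) -> z = 0.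
Proof.
have [_ not_hull] := v_vertex => Avz Av_z; apply: contrapT => z_neq0.
have hull_translate w : w <> 0 -> A (v + w) ->
    conv_hull (conv_hull A `\ v)%classic (v + w).
  move=> w_neq0 Avw; apply: sub_gen_smallest.
  split; first exact: sub_gen_smallest.
  by move=> /eqP /=; rewrite -subr_eq0 addrAC subrr add0r => /eqP.
apply: not_hull; apply: (convex_set_midpoint (@conv_hull_convex _ _ _)).
  exact: hull_translate z_neq0 Avz.
by apply: hull_translate => // /eqP; rewrite oppr_eq0 => /eqP.
Qed.

End ConvexHullVertex.

Lemma subset_sum_subvector (V : nmodType) (n : nat) (a : 'rV[V]_n)
    (S : {set 'I_n}) (A : {set 'I_#|S|}) :
  subset_sum (subvector a S 0) A = subset_sum (a 0) (enum_val @: A).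
Proof.
rewrite /subset_sum big_imset /=; last by move=> j k _ _; apply: enum_val_inj.
by apply: eq_bigr => j _; rewrite mxE.
Qed.

Section KnapsackVertex.
Variables (R : realType) (n : nat) (a : 'rV[int]_n) (b : int) (v : 'rV[R]_n).
Hypothesis v_vertex : vertex (integer_hull (@knapsack R n a b)) v.

Lemma knapsack_vertex_kernel (z : 'rV[R]_n) :
  integer_points z -> \sum_i (a 0 i)%:~R * z 0 i = 0 ->
  (forall i, `|z 0 i| <= v 0 i) -> z = 0.
Proof.
have [[av _] v_int] := conv_hull_vertex_mem v_vertex.
have translate_mem w : integer_points w ->
    \sum_i (a 0 i)%:~R * w 0 i = 0 -> (forall i, `|w 0 i| <= v 0 i) ->
    (knapsack a b `&` @integer_points R n)%classic (v + w).
  move=> w_int aw w_le; split; last by move=> i; rewrite mxE rpredD.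
  split => [|i]; last by have := w_le i; rewrite mxE ler_norml; lra.
  under eq_bigr do rewrite mxE mulrDr.
  by rewrite big_split /= av aw addr0.
move=> z_int az z_le; apply: (conv_hull_vertex_extreme v_vertex).
  exact: translate_mem.
apply: translate_mem => [i||i]; last by rewrite mxE normrN.
  by rewrite mxE rpredN.
by under eq_bigr do rewrite mxE mulrN; rewrite sumrN az oppr0.
Qed.

Lemma knapsack_vertex_ge1 (i : 'I_n) : i \in supp v -> 1 <= v 0 i.
Proof.
have [[_ v_ge0] v_int] := conv_hull_vertex_mem v_vertex.
by rewrite inE => /(norm_intr_ge1 (v_int i)); rewrite ger0_norm.
Qed.

Lemma knapsack_vertex_subset_sum_inj :
  {in powerset (supp v) &, injective (subset_sum (a 0))}.
Proof.
move=> A B; rewrite !powersetE.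
move=> /fintype.subsetP A_supp /fintype.subsetP B_supp eq_sum.
pose indicator (C : {set 'I_n}) : 'rV[R]_n := \row_i (i \in C)%:R.
have sum_indicator C :
    \sum_i (a 0 i)%:~R * indicator C 0 i = (subset_sum (a 0) C)%:~R.
  rewrite rmorph_sum [RHS]big_mkcond; apply: eq_bigr => i _ /=.
  by rewrite mxE mulr_natr mulrb.
have /eqP : indicator A - indicator B = 0.
  apply: knapsack_vertex_kernel => [i||i].
  - by rewrite !mxE rpredB ?rpred_nat.
  - under eq_bigr do rewrite mxE [X in _ + X]mxE mulrBr.
    by rewrite sumrB !sum_indicator eq_sum subrr.
  - have [[_ v_ge0] _] := conv_hull_vertex_mem v_vertex.
    have := v_ge0 i; rewrite !mxE ler_norml.
    have [/A_supp/knapsack_vertex_ge1|_] := boolP (i \in A);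
      have [/B_supp/knapsack_vertex_ge1|_] := boolP (i \in B) => /=; lra.
rewrite subr_eq0 => /eqP /rowP eq_indicator; apply/finset.setP => i.
have /eqP := eq_indicator i.
by rewrite !mxE eqr_nat; case: (i \in A) (i \in B) => [] [].
Qed.

Lemma knapsack_vertex_subvector_sum_inj :
  injective (subset_sum (subvector a (supp v) 0)).
Proof.
have image_sub (A : {set 'I_#|supp v|}) : enum_val @: A \in powerset (supp v).
  rewrite powersetE; apply/fintype.subsetP => _ /imsetP[j _ ->].
  exact: enum_valP.
move=> A B; rewrite !subset_sum_subvector => /knapsack_vertex_subset_sum_inj.
move=> /(_ (image_sub A) (image_sub B)).
by apply: imset_inj; apply: enum_val_inj.
Qed.

End KnapsackVertex.

Theorem theorem4 (R : realType) (n : nat) (a : 'rV[int]_n) (b : int)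
    (a_neq0 : a <> 0) (v : 'rV[R]_n)
    (v_vertex : vertex (integer_hull (@knapsack R n a b)) v) :
  #|supp v|%:R <= log2 (351 / 100 * norm2 R (subvector a (supp v))).
Proof.
apply: injective_subset_sums_le_log2_norm2; first by lra.
exact: knapsack_vertex_subvector_sum_inj v_vertex.
Qed.
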